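(* Let Assumptions 1, 2 and 3 of the context hold. For $x\in\mathbb R^d$ let $B(x):=\mathrm{Jac}_xb$ denote the Jacobian matrix of $b$ at $x$, and let $\mathbf s$ be a saddle point of $V$, i.e. a critical point of $V$ of index $1$. (i) The matrix $\operatorname{Hess}V(\mathbf s)+B^*(\mathbf s)\in\mathcal M_d(\mathbb R)$ admits precisely one negative eigenvalue $\mu=\mu(\mathbf s)$, which has moreover geometric multiplicity one. (ii) Denote by $\xi=\xi(\mathbf s)$ one of the two (real) unit eigenvectors of $\operatorname{Hess}V(\mathbf s)+B^*(\mathbf s)$ associated with $\mu$. The real symmetric matrix $$M_V:=\operatorname{Hess}V(\mathbf s)+2|\mu|\,\xi\xi^*$$ is then positive definite and its determinant satisfies $\det M_V=-\det\operatorname{Hess}V(\mathbf s)$. (iii) Lastly, denoting by $\lambda_1=\lambda_1(\mathbf s)$ the negative eigenvalue of $\operatorname{Hess}V(\mathbf s)$, it holds $|\mu|\ge|\lambda_1|$, with equality if and only if $B^*(\mathbf s)\xi=0$, and $$\langle(\operatorname{Hess}V(\mathbf s))^{-1}\xi,\xi\rangle=\frac1\mu<0.$$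
   Context: Setting. $d\ge2$; $U_0,\nu:\mathbb R^d\to\mathbb R^d$ are smooth vector fields independent of $h\in(0,1]$, $U_h=U_0+h\nu$, $L=-h\Delta+U_h\cdot\nabla$, with formal adjoint $L^\dagger=-\operatorname{div}\circ(h\nabla+U_h)$. Assumption 1: there is a smooth $V:\mathbb R^d\to\mathbb R$ with $L^\dagger(e^{-V/h})=0$ for every $h\in(0,1]$. Set $b:=U_0-\nabla V$. (Equivalently: $b\cdot\nabla V=0$, $\operatorname{div}\nu=0$, $\operatorname{div}b=\nu\cdot\nabla V$.) Assumption 2: there exist $C>0$ and a compact $K\subset\mathbb R^d$ such that $V\ge-C$ on $\mathbb R^d$; $|\nabla V(x)|\ge\frac1C$ and $|\operatorname{Hess}V(x)|\le C|\nabla V(x)|^2$ for all $x\in\mathbb R^d\setminus K$; and $|b(x)|+|\nu(x)|\le C(1+|\nabla V(x)|)$ for all $x\in\mathbb R^d$. Assumption 3: $V$ is a Morse function. $B^*$ denotes the transpose of the real matrix $B$, and the Jacobian matrix of $b$ has entries $(\partial_jb_i)_{i,j}$. *)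

(* Defs.v *)
From HB Require Import structures.
From mathcomp Require Import all_boot all_order all_algebra.
From mathcomp Require Import polyrcf.
From mathcomp Require Import all_classical all_reals all_analysis.

Set Implicit Arguments.
Unset Strict Implicit.
Unset Printing Implicit Defensive.
Import Order.TTheory GRing.Theory Num.Theory.
Import numFieldNormedType.Exports.
Local Open Scope ring_scope.

(* Points of R^d are column vectors. *)

Section Euclidean.
Context {R : realType}.

Definition dot (d : nat) (u v : 'cV[R]_d) : R := \sum_i u i 0 * v i 0.

(* The library norm on matrices is the sup norm; this is the Frobenius norm,
   which is the Euclidean norm when [n = 1]. *)
Definition enorm (m n : nat) (A : 'M[R]_(m, n)) : R :=
  Num.sqrt (\sum_i \sum_j A i j ^+ 2).

Definition pos_def (d : nat) (M : 'M[R]_d) : Prop :=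
  M^T = M /\ forall v : 'cV[R]_d, v != 0 -> 0 < dot (M *m v) v.

(* The library's [eigenvalue] and [eigenspace] are those of [v |-> v *m A] on
   row vectors; transposing gives those of [v |-> A *m v] on columns. *)
Definition col_eigenvalue (d : nat) (A : 'M[R]_d) (a : R) : bool :=
  eigenvalue A^T a.

Definition geom_mult (d : nat) (A : 'M[R]_d) (a : R) : nat :=
  \rank (eigenspace A^T a).

(* Number of negative eigenvalues, counted with algebraic multiplicity. *)
Definition neg_index (d : nat) (A : 'M[R]_d) : nat :=
  (\sum_(a <- rootsR (char_poly A) | (a < 0)%R) mup a (char_poly A))%N.

End Euclidean.

Section Calculus.
Context {R : realType} {d : nat}.
Implicit Types (f : 'cV[R]_d -> R) (F : 'cV[R]_d -> 'cV[R]_d) (x : 'cV[R]_d).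

Definition partial (i : 'I_d) f : 'cV[R]_d -> R :=
  fun x => 'D_(delta_mx i 0) f x.

(* [s] lists the successive directions of differentiation: every iterated
   partial derivative, [f] included, is Frechet differentiable everywhere. *)
Definition smooth f : Prop :=
  forall (s : seq 'I_d) x, differentiable (foldr partial f s) x.

Definition smooth_field F : Prop := forall i, smooth (fun x => F x i 0).

Definition grad f x : 'cV[R]_d := \col_i partial i f x.

Definition hess f x : 'M[R]_d := \matrix_(i, j) partial i (partial j f) x.

Definition div F x : R := \sum_i partial i (fun y => F y i 0) x.

Definition jac F x : 'M[R]_d :=
  \matrix_(i, j) partial j (fun y => F y i 0) x.

Definition critical f x : Prop := grad f x = 0.

Definition morse f : Prop := forall x, critical f x -> hess f x \in unitmx.

Definition saddle f x : Prop := critical f x /\ neg_index (hess f x) = 1%N.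

End Calculus.

Section Diffusion.
Context {R : realType} {d : nat}.

Definition Uh (U0 nu : 'cV[R]_d -> 'cV[R]_d) (h : R) : 'cV[R]_d -> 'cV[R]_d :=
  fun x => U0 x + h *: nu x.

(* Formal adjoint of [L = - h Laplacian + Uh . grad]. *)
Definition Ldag (U0 nu : 'cV[R]_d -> 'cV[R]_d) (h : R) (u : 'cV[R]_d -> R) :
    'cV[R]_d -> R :=
  fun x => - div (fun y => h *: grad u y + u y *: Uh U0 nu h y) x.

Definition stationary (U0 nu : 'cV[R]_d -> 'cV[R]_d) (V : 'cV[R]_d -> R) : Prop :=
  forall h : R, 0 < h <= 1 ->
  forall x, Ldag U0 nu h (fun y => expR (- (V y / h))) x = 0.

Definition bfield (U0 : 'cV[R]_d -> 'cV[R]_d) (V : 'cV[R]_d -> R) :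
    'cV[R]_d -> 'cV[R]_d :=
  fun x => U0 x - grad V x.

Definition growth (b nu : 'cV[R]_d -> 'cV[R]_d) (V : 'cV[R]_d -> R) : Prop :=
  exists (C : R) (K : set 'cV[R]_d),
    [/\ 0 < C,
        compact K,
        forall x, - C <= V x,
        forall x, ~ K x -> C^-1 <= enorm (grad V x) /\
                           enorm (hess V x) <= C * enorm (grad V x) ^+ 2
      & forall x, enorm (b x) + enorm (nu x) <= C * (1 + enorm (grad V x))].

End Diffusion.

(* Main.v *)
Require Import Defs.
From HB Require Import structures.
From mathcomp Require Import all_boot all_order all_algebra.
From mathcomp Require Import polyrcf complex spectral.
From mathcomp Require Import all_classical all_reals all_analysis.
From mathcomp Require Import ring lra.
Set Implicit Arguments.
Unset Strict Implicit.
Unset Printing Implicit Defensive.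
Import Order.TTheory GRing.Theory Num.Theory.
Import numFieldNormedType.Exports.
Local Open Scope ring_scope.

(** Write [H] for the Hessian and [B] for the Jacobian matrix of [b] at the
    saddle point.  Everything rests on the fact that [H *m B] is
    antisymmetric.

    Stationarity of [exp (- V / h)] says that a polynomial in [h] vanishes on
    an interval, and its constant coefficient is [b . grad V]; hence
    [b . grad V = 0] ([stationary_orthogonal]).  Differentiating this identity
    once at a critical point gives [H *m b = 0], so [b] vanishes there;
    differentiating twice, and using the symmetry of second derivatives
    ([derive_deriveC]), gives [B^T *m H = - (H *m B)]
    ([orthogonal_critical]).

    The rest is linear algebra.  Put [A = H + B^T].  Then
    [A *m H = H ^ 2 + B^T *m H] is a positive definite matrix plus an
    antisymmetric one, so its determinant is positive; as [\det H < 0] at an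
    index-one point, [\det A < 0] and [A] has a negative eigenvalue
    ([det_perturbed_lt0], [det_lt0_eigenvalue]).

    For uniqueness, substitute [xi = H *m eta].  If [xi1], [xi2] are
    eigenvectors of [A] for [a1], [a2], then cancelling the antisymmetric part
    gives [(a1 + a2) <H eta1, eta2> = 2 <xi1, xi2>] ([eigen_pairing]).  For
    negative [a1], [a2] this makes the form [<H x, x>] nonpositive on the span
    of [eta1] and [eta2].  Since [H] is positive definite on a hyperplane
    ([index1_hyperplane]), this span is at most a line
    ([neg_eigen_colinear]): this proves both that the negative eigenvalue
    [mu] is unique and that its eigenspace is a line.  With [eta1 = eta2] the
    pairing reads [<H^-1 xi, xi> = 1 / mu].

    From there, [MV] is a rank-one perturbation that turns the value of the
    form along [eta] from [1 / mu] into [- 1 / mu] and leaves the form on the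
    [H]-orthogonal complement of [eta] alone; it is positive there because
    [eta] already uses up the only negative direction ([form_orth_pos]).
    Finally, the negative eigenvalue [lam] of [H] satisfies
    [lam * <H eta, eta> <= |H eta| ^ 2], with equality only on its eigenspace
    ([neg_eigenvalue_form]); at [eta] this is [lam / mu <= 1]. *)

(** * The Euclidean inner product *)

Section Dot.
Variables (R : realType) (n : nat).
Implicit Types (u v w : 'cV[R]_n) (M : 'M[R]_n).

Lemma dotE u v : dot u v = (u^T *m v) 0 0.
Proof. by rewrite mxE; apply: eq_bigr => i _; rewrite mxE. Qed.

Lemma dotC u v : dot u v = dot v u.
Proof. by apply: eq_bigr => i _; rewrite mulrC. Qed.

Lemma dot_ge0 u : 0 <= dot u u.
Proof. by apply: sumr_ge0 => i _; rewrite -expr2 sqr_ge0. Qed.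

Lemma dot_eq0 u : (dot u u == 0) = (u == 0).
Proof.
apply/idP/eqP => [|->]; last by rewrite /dot big1 // => i _; rewrite mxE mul0r.
rewrite psumr_eq0 => [/allP u0|i _]; last by rewrite -expr2 sqr_ge0.
apply/colP => i; have := u0 i (mem_index_enum _).
by rewrite -expr2 sqrf_eq0 mxE => /eqP.
Qed.

Lemma dot_gt0 u : u != 0 -> 0 < dot u u.
Proof. by rewrite lt0r dot_eq0 dot_ge0 andbT. Qed.

Lemma dotDl u v w : dot (u + v) w = dot u w + dot v w.
Proof. by rewrite !dotE linearD mulmxDl mxE. Qed.

Lemma dotZl a u v : dot (a *: u) v = a * dot u v.
Proof. by rewrite !dotE linearZ -scalemxAl mxE. Qed.

Lemma dot0l u : dot 0 u = 0.
Proof. by rewrite -(scale0r 0) dotZl mul0r. Qed.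

Lemma dotDr u v w : dot u (v + w) = dot u v + dot u w.
Proof. by rewrite !(dotC u) dotDl. Qed.

Lemma dotZr a u v : dot u (a *: v) = a * dot u v.
Proof. by rewrite !(dotC u) dotZl. Qed.

Lemma dotNl u v : dot (- u) v = - dot u v.
Proof. by rewrite -scaleN1r dotZl mulN1r. Qed.

Lemma dotNr u v : dot u (- v) = - dot u v.
Proof. by rewrite dotC dotNl dotC. Qed.

Lemma dot_mulmxl M u v : dot (M *m u) v = dot u (M^T *m v).
Proof. by rewrite !dotE trmx_mul mulmxA. Qed.

Lemma dot_enorm u : enorm u = 1 -> dot u u = 1.
Proof.
move=> u1; rewrite -[RHS](expr1n _ 2) -u1 sqr_sqrtr; last first.
  by apply: sumr_ge0 => i _; apply: sumr_ge0 => j _; rewrite sqr_ge0.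
by apply: eq_bigr => i _; rewrite big_ord1 expr2.
Qed.

Lemma col_eigenvalueP M a :
  reflect (exists2 x : 'cV_n, M *m x = a *: x & x != 0) (col_eigenvalue M a).
Proof.
apply: (iffP eigenvalueP) => -[x Mx x0]; exists x^T; rewrite ?trmx_eq0 //.
  by rewrite -[M]trmxK -trmx_mul Mx linearZ.
by rewrite -trmx_mul Mx linearZ.
Qed.

End Dot.

(** * Determinants and eigenvalues *)

(** A monic polynomial tends to [+oo], so the intermediate value theorem applies. *)
Lemma monic_pos_root (R : rcfType) (p : {poly R}) :
  p \is monic -> p.[0] < 0 -> exists2 t, 0 < t & root p t.
Proof.
move=> /monicP pm p0; have /poly_pinfty_gt_lc[y py] : 0 < lead_coef p.
  by rewrite pm.
pose b := Num.max y 1.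
have b0 : 0 < b by rewrite /b lt_max ltr01 orbT.
have pb : 0 < p.[b] by rewrite (lt_le_trans _ (py b _)) ?pm // /b le_max lexx.
have [|t] := @poly_ivtoo _ p 0 b (ltW b0); first by rewrite nmulr_rlt0.
by rewrite in_itv /= => /andP[t0 _] rt; exists t.
Qed.

(** The characteristic polynomial of [- A^T] is monic and takes the value
    [\det A] at [0]; its positive roots are the opposites of the negative
    eigenvalues of [A]. *)
Lemma det_lt0_eigenvalue (R : realType) n (A : 'M[R]_n) :
  \det A < 0 -> exists2 a, a < 0 & col_eigenvalue A a.
Proof.
move=> dA; have [||t t0] := @monic_pos_root _ (char_poly (- A^T)).
- exact: char_poly_monic.
- by rewrite horner_coef0 char_poly_det -detZ scalerN scaleN1r opprK det_tr.
rewrite -eigenvalue_root_char => /eigenvalueP[v vA v0].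
exists (- t); rewrite ?oppr_lt0 //; apply/eigenvalueP; exists v => //.
by rewrite scaleNr -vA mulmxN opprK.
Qed.

(** A singular [M] would kill a vector, and a
    negative determinant would give an eigenvector with negative eigenvalue;
    both contradict the positivity of the form. *)
Lemma det_gt0_of_form (R : realType) n (M : 'M[R]_n) :
  (forall x, x != 0 -> 0 < dot (M *m x) x) -> 0 < \det M.
Proof.
move=> Mpos; rewrite ltNge le_eqVlt; apply/negP => /orP[|/det_lt0_eigenvalue].
  rewrite -det_tr => /det0P[v v0 vM].
  have := Mpos v^T; rewrite trmx_eq0 => /(_ v0).
  by rewrite -[M]trmxK -trmx_mul vM trmx0 dot0l ltxx.
move=> [a a0 /col_eigenvalueP[x Mx x0]].
by have := Mpos _ x0; rewrite Mx dotZl nmulr_rgt0 // ltNge dot_ge0.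
Qed.

(** Two factorizations of one bordered matrix into block triangular ones. *)
Lemma det_rank1 (R : comNzRingType) n (u : 'cV[R]_n) (v : 'rV[R]_n) :
  \det (1%:M + u *m v) = 1 + (v *m u) 0 0.
Proof.
have E1 : block_mx 1%:M u (- v) (1%:M : 'M[R]_1) =
    block_mx 1%:M 0 (- v) 1%:M *m block_mx 1%:M u 0 (1%:M + v *m u).
  rewrite mulmx_block !(mul1mx, mulmx1, mul0mx, mulmx0, addr0, add0r) mulNmx.
  by rewrite [- _ + _]addrC addrK.
have E2 : block_mx 1%:M u (- v) (1%:M : 'M[R]_1) =
    block_mx (1%:M + u *m v) u 0 1%:M *m block_mx 1%:M 0 (- v) 1%:M.
  rewrite mulmx_block !(mul1mx, mulmx1, mul0mx, mulmx0, addr0, add0r) mulmxN.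
  by rewrite addrK.
have := congr1 determinant E1; rewrite {1}E2 !det_mulmx !det_ublock !det_lblock.
by rewrite !det1 !mul1r !mulr1 => ->; rewrite det_mx11 !mxE eqxx.
Qed.

(** * Real symmetric matrices and their index *)

(** The spectral theorem for Hermitian matrices diagonalizes [H] over
    [complex R] with real eigenvalues, and two real matrices that are similar
    over the complex numbers are similar over the reals. *)
Lemma symmetric_diagonalizable (R : rcfType) n (H : 'M[R]_n) :
  H^T = H ->
  exists (P : 'M[R]_n) (D : 'rV[R]_n),
    P \in unitmx /\ P *m H = diag_mx D *m P.
Proof.
move=> Hsym.
pose f : {rmorphism R -> complex R} := real_complex R.
have fP m k (M : 'M[complex R]_(m, k)) : M \is a mxOver Num.real ->
    exists M', M = map_mx f M'.
  move=> Mr; exists (map_mx (@complex.Re R) M).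
  by apply/matrixP => i j; rewrite !mxE /f /= RRe_real // (mxOverP Mr).
pose HC := map_mx f H.
have HCr : HC \is a mxOver Num.real.
  apply/mxOverP => i j; rewrite mxE.
  by apply/complex_realP; exists (H i j).
have HCs : HC \is symmetricmx.
  by apply/is_hermitianmxP; rewrite expr0 scale1r map_mx_id // map_trmx Hsym.
have HCh := realsym_hermsym HCs HCr.
have [D Dr] := fP _ _ _ (hermitian_spectral_diag_real HCh).
have /orthomx_spectralP := hermitian_normalmx HCh.
set P := spectralmx HC; have Pu : P \in unitmx := spectral_unit HC.
rewrite Dr => HCE.
have DCr : diag_mx (map_mx f D) \is a mxOver Num.real.
  by rewrite -Dr; apply/mxOver_diag/hermitian_spectral_diag_real.
have [|Q /andP[Qr Qu]] := @real_similar _ _ HC (diag_mx (map_mx f D)) _ HCr DCr.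
  by exists P => //; apply/similarP => //; rewrite [in LHS]HCE -!mulmxA mulKVmx.
move=> /(similarP Qu); have [Q' QE] := fP _ _ _ Qr.
rewrite QE -map_diag_mx -!map_mxM => /map_mx_inj QH.
by exists Q', D; split=> //; rewrite -(map_unitmx f) -QE.
Qed.

Lemma mup_prod_XsubC (F : fieldType) n (D : 'I_n -> F) (a : F) :
  mup a (\prod_i ('X - (D i)%:P)) = (\sum_i (a == D i))%N.
Proof.
elim: n D => [|n IHn] D; first by rewrite !big_ord0 mupNroot // root1.
have nz m (E : 'I_m -> F) : \prod_i ('X - (E i)%:P) != 0.
  by rewrite prodf_seq_neq0; apply/allP => i _; rewrite polyXsubC_eq0.
rewrite !big_ord_recl mupM ?polyXsubC_eq0 // IHn -['X - _]expr1 mup_XsubCX.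
by rewrite eq_sym; case: eqVneq.
Qed.

Lemma char_poly_similar (F : fieldType) n (P A B : 'M[F]_n) :
  P \in unitmx -> P *m A = B *m P -> char_poly A = char_poly B.
Proof.
move=> Pu PAB; have Pd : \det (map_mx polyC P) != 0.
  by rewrite det_map_mx polyC_eq0 -unitfE -unitmxE.
apply: (mulfI Pd); rewrite /char_poly -det_mulmx [RHS]mulrC -det_mulmx.
rewrite /char_poly_mx mulmxBr mulmxBl -!map_mxM PAB.
by rewrite scalar_mxC.
Qed.

(** Reduces the index to a count of negative diagonal entries, where
    repeated eigenvalues need no special treatment. *)
Lemma neg_index_diag (R : realType) n (H P : 'M[R]_n) (D : 'rV[R]_n) :
  P \in unitmx -> P *m H = diag_mx D *m P ->
  neg_index H = (\sum_i (D 0 i < 0)%R)%N.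
Proof.
move=> Pu PH.
have pE : char_poly H = \prod_i ('X - (D 0 i)%:P).
  rewrite (char_poly_similar Pu PH) char_poly_trig ?diag_mx_is_trig //.
  by apply: eq_bigr => i _; rewrite mxE eqxx.
have p0 : char_poly H != 0 by rewrite monic_neq0 ?char_poly_monic.
rewrite /neg_index; under eq_bigr do rewrite pE mup_prod_XsubC.
rewrite exchange_big; apply: eq_bigr => i _ /=.
have iroots : D 0 i \in rootsR (char_poly H).
  have := roots_on_rootsR p0 (D 0 i); rewrite in_itv /= => <-.
  by rewrite pE rootE horner_prod (bigD1 i) //= hornerXsubC subrr mul0r.
have [Di|Di] := boolP (D 0 i < 0); last first.
  rewrite big1 // => a a0; case: eqP => // aD; by rewrite -aD a0 in Di.
rewrite big_mkcond (bigD1_seq (D 0 i)) ?uniq_roots //= Di eqxx.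
by rewrite big1 // => a /negPf->; case: ifP.
Qed.

(** Diagonalize [H] and let [w] extract the coordinate of the negative
    eigenvalue, so that a vector orthogonal to [w] only involves positive ones.
    The rows of [P] are not orthonormal, but their Gram matrix [G] commutes
    with [D]; a nonzero entry of [G] therefore joins equal eigenvalues, and
    on these vectors [D *m G] can be rewritten as [S *m G *m S] with
    [S] the square root of [D], which exhibits the form as a sum of squares. *)
Lemma index1_hyperplane (R : realType) n (H : 'M[R]_n) :
  H^T = H -> H \in unitmx -> neg_index H = 1%N ->
  \det H < 0 /\
  exists w, forall x, x != 0 -> dot w x = 0 -> 0 < dot (H *m x) x.
Proof.
move=> Hs Hu; have [P [D [Pu PH]]] := symmetric_diagonalizable Hs.
rewrite (neg_index_diag Pu PH) => /eqP/sum_nat_eq1[i0 [_]].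
move=> /eqP; rewrite eqb1 => D0 Dpos.
have HE : H = invmx P *m diag_mx D *m P by rewrite -mulmxA -PH mulKmx.
have detE : \det H = \prod_i D 0 i.
  rewrite HE !det_mulmx det_inv det_diag mulrAC mulVf ?mul1r //.
  by rewrite -unitfE -unitmxE.
have Dn0 i : D 0 i != 0.
  have: \prod_i D 0 i != 0 by rewrite -detE -unitfE -unitmxE.
  by apply: contra_neq => Di; rewrite (bigD1 i) //= Di mul0r.
have Dp i : i != i0 -> 0 < D 0 i.
  move=> ii0; have /eqP := Dpos _ ii0 isT; rewrite eqb0 -leNgt.
  by rewrite lt_neqAle eq_sym Dn0.
split.
  by rewrite detE (bigD1 i0) //= pmulr_llt0 //; apply: prodr_gt0 => i; exact: Dp.
pose G := P *m P^T.
have DG : diag_mx D *m G = G *m diag_mx D.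
  rewrite /G mulmxA -PH -[diag_mx D]trmxK tr_diag_mx -mulmxA -{1}Hs -trmx_mul.
  by rewrite PH trmx_mul tr_diag_mx mulmxA.
exists (col i0 (invmx P)) => x x0 wx.
pose c := x^T *m invmx P.
have ci0 : c 0 i0 = 0.
  by rewrite -wx /c /dot mxE; apply: eq_bigr => i _; rewrite !mxE mulrC.
have xE : x^T = c *m P by rewrite mulmxKV.
have GE : P *m P^T = G by [].
clearbody c G.
pose c' : 'rV[R]_n := \row_i (Num.sqrt (D 0 i) * c 0 i).
have -> : dot (H *m x) x = dot (c' *m P)^T (c' *m P)^T.
  rewrite !dotE trmxK trmx_mul Hs xE -[x]trmxK xE !trmx_mul mulmxA.
  rewrite -[c *m P *m H]mulmxA PH -!mulmxA !(mulmxA P) GE (mulmxA (diag_mx D)).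
  rewrite !mulmxA -(mulmxA c) !mxE; apply: eq_bigr => j _; rewrite !mxE !mulr_suml.
  apply: eq_bigr => i _; rewrite mul_diag_mx !mxE.
  have [->|ii0] := eqVneq i i0; first by rewrite ci0 !(mulr0, mul0r).
  have [->|ji0] := eqVneq j i0; first by rewrite ci0 !(mulr0, mul0r).
  (* This entry of [DG] reads [D 0 i * G i j = G i j * D 0 j]. *)
  have /matrixP/(_ i j) := DG; rewrite mul_diag_mx mul_mx_diag !mxE.
  rewrite [X in _ = X]mulrC => /eqP.
  rewrite -subr_eq0 -mulrBl mulf_eq0 subr_eq0 orbC => /orP[/eqP->|/eqP ij].
    by rewrite !(mulr0, mul0r).
  have := sqr_sqrtr (ltW (Dp _ ii0)); rewrite -ij; move: (Num.sqrt _) => r <-.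
  by ring.
apply: dot_gt0; apply: contra_neq x0 => /(congr1 trmx).
rewrite trmxK trmx0 => cP0.
have c0 : c = 0.
  apply/rowP => i; have [->|ii0] := eqVneq i i0; first by rewrite ci0 mxE.
  have /rowP/(_ i) : c' = 0 by rewrite -(mulmxK Pu c') cP0 mul0mx.
  rewrite !mxE => /eqP; rewrite mulf_eq0 sqrtr_eq0 leNgt Dp //=.
  by move=> /eqP.
by rewrite -[x]trmxK xE c0 mul0mx trmx0.
Qed.

(** * Quadratic forms that are positive on a hyperplane *)

Section IndexOne.
Variables (R : realType) (n : nat) (H T : 'M[R]_n) (w : 'cV[R]_n).
Implicit Types x y : 'cV[R]_n.
Hypothesis Hsym : H^T = H.
Hypothesis w_pos : forall x : 'cV[R]_n, x != 0 -> dot w x = 0 -> 0 < dot (H *m x) x.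

Lemma dot_symC x y : dot (H *m x) y = dot (H *m y) x.
Proof. by rewrite dot_mulmxl Hsym dotC. Qed.

Lemma form_neg_w x : x != 0 -> dot (H *m x) x <= 0 -> dot w x != 0.
Proof. by move=> x0; apply: contraTneq => /(w_pos x0); rewrite -ltNge. Qed.

(** If the form is nonpositive on the span of [x] and [y], the combination
    of [x] and [y] that is orthogonal to [w] must vanish. *)
Lemma form_semineg_plane x y :
  (forall a b, dot (H *m (a *: x + b *: y)) (a *: x + b *: y) <= 0) ->
  dot w y *: x = dot w x *: y.
Proof.
move=> neg; apply/eqP; rewrite -subr_eq0 -scaleNr; apply: contraT => z0.
have := w_pos z0; rewrite ltNge neg dotDr !dotZr mulNr [X in X - _]mulrC subrr.
by move=> /(_ erefl).
Qed.

(** Otherwise the form would be nonpositive on the span of [x] and [y], which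
    forces [y] to be a multiple of [x], against [dot (H *m x) y = 0]. *)
Lemma form_orth_pos x y : dot (H *m x) x < 0 -> dot (H *m x) y = 0 -> y != 0 ->
  0 < dot (H *m y) y.
Proof.
move=> xneg xy y0; rewrite ltNge; apply: contra_neqN y0 => yneg.
have x0 : x != 0.
  by apply: contraTneq xneg => ->; rewrite dotC dot0l ltxx.
have wx := form_neg_w x0 (ltW xneg).
have /form_semineg_plane E a b :
    dot (H *m (a *: x + b *: y)) (a *: x + b *: y) <= 0.
  rewrite mulmxDr -!scalemxAr !(dotDl, dotDr, dotZl, dotZr) (dot_symC y x) xy.
  by nra.
have yE : y = (dot w y / dot w x) *: x.
  by rewrite mulrC -scalerA E scalerA mulVf ?scale1r.
have /eqP : dot w y / dot w x = 0.
  move: xy; rewrite yE dotZr => /eqP; rewrite mulf_eq0 (lt_eqF xneg) orbF.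
  by rewrite -yE => /eqP.
by move=> /eqP k0; rewrite yE k0 scale0r.
Qed.

Hypothesis TH : T *m H = - (H *m T^T).

(** Pair the first equation with [y], the second with [x], and add: the
    antisymmetric matrix [T *m H] drops out. *)
Lemma eigen_pairing x y a b :
  (H + T) *m (H *m x) = a *: (H *m x) -> (H + T) *m (H *m y) = b *: (H *m y) ->
  (a + b) * dot (H *m x) y = 2 * dot (H *m x) (H *m y).
Proof.
move=> Ex Ey; have := congr1 (fun z => dot z y) Ex; have := congr1 (fun z => dot z x) Ey.
rewrite !mulmxDl !dotDl !dotZl (dot_symC y x) => Ey' Ex'.
have -> : (a + b) * dot (H *m x) y = a * dot (H *m x) y + b * dot (H *m x) y.
  by ring.
rewrite -Ex' -Ey' (dot_symC (H *m x)) (dot_symC (H *m y)) (dotC (H *m y)).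
have -> : dot (T *m (H *m y)) x = - dot (T *m (H *m x)) y.
  rewrite !mulmxA dot_mulmxl trmx_mul Hsym -[H *m T^T]opprK -TH.
  by rewrite mulNmx dotC dotNl.
by ring.
Qed.

(** By [eigen_pairing] the Gram matrix of the form on [x], [y] has entries
    [<Hx, Hx> / a], [2 <Hx, Hy> / (a + b)], [<Hy, Hy> / b]; it is negative
    semidefinite because [4 a b <= (a + b) ^ 2] and by the Cauchy-Schwarz inequality. *)
Lemma neg_eigen_colinear (x y : 'cV[R]_n) (a b : R) :
  a < 0 -> b < 0 -> x != 0 ->
  (H + T) *m (H *m x) = a *: (H *m x) -> (H + T) *m (H *m y) = b *: (H *m y) ->
  exists k, y = k *: x.
Proof.
move=> a0 b0 x0 Ex Ey.
have Pxx := eigen_pairing Ex Ex; have Pxy := eigen_pairing Ex Ey.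
have Pyy := eigen_pairing Ey Ey.
have ab : a + b < 0 by lra.
suff /form_semineg_plane E c d :
    dot (H *m (c *: x + d *: y)) (c *: x + d *: y) <= 0.
  have wx : dot w x != 0.
    apply: form_neg_w => //; move: Pxx (dot_ge0 (H *m x)).
    by rewrite -mulr2n; nra.
  exists (dot w y / dot w x).
  by rewrite mulrC -scalerA E scalerA mulVf ?scale1r.
rewrite mulmxDr -!scalemxAr !(dotDl, dotDr, dotZl, dotZr) (dot_symC y x).
(* Completing the square in [c *: (H *m x) + (k * d) *: (H *m y)]. *)
pose k := 2 * a / (a + b).
have := dot_ge0 (c *: (H *m x) + (k * d) *: (H *m y)).
rewrite !(dotDl, dotDr, dotZl, dotZr) (dotC (H *m y) (H *m x)).
have -> : dot (H *m x) x = dot (H *m x) (H *m x) / a.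
  by apply: (mulIf (ltr0_neq0 a0)); rewrite divfK ?ltr0_neq0 //; lra.
have -> : dot (H *m y) y = dot (H *m y) (H *m y) / b.
  by apply: (mulIf (ltr0_neq0 b0)); rewrite divfK ?ltr0_neq0 //; lra.
have -> : dot (H *m x) y = 2 * dot (H *m x) (H *m y) / (a + b).
  by apply: (mulIf (ltr0_neq0 ab)); rewrite divfK ?ltr0_neq0 //; lra.
have := dot_ge0 (H *m y).
move: (dot (H *m x) (H *m x)) (dot (H *m x) (H *m y)) (dot (H *m y) _) => p q r r0.
set S := (X in X <= 0); set Q := (X in 0 <= X) => Q0.
have -> : S = a^-1 * Q + d ^+ 2 * r * ((a - b) / (a + b)) ^+ 2 / b.
  by rewrite /S /Q /k; field; rewrite !ltr0_neq0.
rewrite -[leRHS]addr0 lerD //; first by rewrite nmulr_rle0 ?invr_lt0.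
apply: mulr_ge0_le0; last by rewrite invr_le0 ltW.
by rewrite mulr_ge0 ?sqr_ge0 // mulr_ge0 ?sqr_ge0.
Qed.

End IndexOne.

(** * Antisymmetric perturbations of a matrix of index one *)

Section IndexOneUnit.
Variables (R : realType) (n : nat) (H T : 'M[R]_n).
Implicit Types x y : 'cV[R]_n.
Hypothesis Hsym : H^T = H.
Hypothesis Hunit : H \in unitmx.
Hypothesis Hidx : neg_index H = 1%N.
Hypothesis TH : T *m H = - (H *m T^T).

(** [neg_eigen_colinear] for the eigenvectors themselves; it holds for two
    eigenvalues at once, so that it yields uniqueness of the eigenvalue and
    simplicity of the eigenspace together. *)
Lemma neg_eigenvector_colinear x y a b :
  a < 0 -> b < 0 -> x != 0 -> (H + T) *m x = a *: x -> (H + T) *m y = b *: y ->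
  exists k, y = k *: x.
Proof.
have [_ [w wP]] := index1_hyperplane Hsym Hunit Hidx.
move=> a0 b0 x0 Ex Ey.
have := @neg_eigen_colinear _ _ _ _ _ Hsym wP TH (invmx H *m x) (invmx H *m y) _ _ a0 b0.
rewrite !mulKVmx // => /(_ _ Ex Ey)[].
  by apply: contra_neq x0 => /(congr1 (mulmx H)); rewrite mulKVmx // mulmx0.
move=> k /(congr1 (mulmx H)); rewrite -scalemxAr !mulKVmx // => yE.
by exists k.
Qed.

Lemma neg_eigenvalue_unique a b : a < 0 -> b < 0 ->
  col_eigenvalue (H + T) a -> col_eigenvalue (H + T) b -> a = b.
Proof.
move=> a0 b0 /col_eigenvalueP[x Ex x0] /col_eigenvalueP[y Ey y0].
have [k yE] := neg_eigenvector_colinear a0 b0 x0 Ex Ey.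
move: Ey; rewrite yE -scalemxAr Ex !scalerA => /eqP.
rewrite -subr_eq0 -scalerBl scaler_eq0 (negPf x0) orbF mulrC -mulrBl mulf_eq0.
move=> /orP[|/eqP k0]; first by rewrite subr_eq0 => /eqP.
by move: y0; rewrite yE k0 scale0r eqxx.
Qed.

Lemma geom_mult_neg a : a < 0 -> col_eigenvalue (H + T) a ->
  geom_mult (H + T) a = 1%N.
Proof.
move=> a0 /col_eigenvalueP[x Ex x0]; apply/eqP; rewrite eqn_leq.
have rx : \rank x^T = 1%N by rewrite rank_rV trmx_eq0 x0.
apply/andP; split; rewrite -{1}rx mxrankS //; last first.
  by apply/eigenspaceP; rewrite -trmx_mul Ex linearZ.
apply/row_subP => i; have /eigenspaceP : (row i (eigenspace (H + T)^T a) <=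
  eigenspace (H + T)^T a)%MS by rewrite row_sub.
move: (row i _) => v /(congr1 trmx); rewrite trmx_mul trmxK linearZ /= => Ev.
have [k vE] := neg_eigenvector_colinear a0 a0 x0 Ex Ev.
by apply/sub_rVP; exists k; rewrite -[v]trmxK vE linearZ.
Qed.

(** [(H + T) *m H] has the same quadratic form as [H *m H], so its determinant
    is positive, while [\det H] is negative. *)
Lemma det_perturbed_lt0 : \det (H + T) < 0.
Proof.
have [dH _] := index1_hyperplane Hsym Hunit Hidx.
have : 0 < \det ((H + T) *m H).
  apply: det_gt0_of_form => x x0; rewrite mulmxDl mulmxDl dotDl -mulmxA.
  rewrite [X in X + _]dot_mulmxl Hsym.
  have -> : dot (T *m H *m x) x = 0.
    have : dot (T *m H *m x) x = - dot (T *m H *m x) x.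
      rewrite {1}dot_mulmxl trmx_mul Hsym -[H *m T^T]opprK -TH.
      by rewrite mulNmx dotC dotNl.
    by move=> ?; lra.
  rewrite addr0; apply: dot_gt0; apply: contra_neq x0 => /(congr1 (mulmx (invmx H))).
  by rewrite mulKmx // mulmx0.
by rewrite det_mulmx nmulr_lgt0.
Qed.

Lemma invform_eigenvector x a : a < 0 -> dot x x = 1 -> (H + T) *m x = a *: x ->
  dot (invmx H *m x) x = a^-1.
Proof.
move=> a0 x1 Ex; have := @eigen_pairing _ _ _ _ Hsym TH (invmx H *m x) (invmx H *m x) a a.
rewrite !mulKVmx // x1 dotC => /(_ Ex Ex) ?.
by apply: (mulfI (ltr0_neq0 a0)); rewrite divff ?ltr0_neq0 //; lra.
Qed.

End IndexOneUnit.

Section Negative.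
Variables (R : realType) (n : nat) (H : 'M[R]_n).
Implicit Types x y xi : 'cV[R]_n.
Hypothesis Hsym : H^T = H.
Hypothesis Hunit : H \in unitmx.
Hypothesis Hidx : neg_index H = 1%N.

(** Split [x] as [t *: eta + y] with [eta = H^-1 xi] and [y] orthogonal to
    [eta] for the form of [H].  With [s = dot xi x] the first part contributes
    [mu * s ^ 2], which the rank-one term [- 2 * mu * s ^ 2] overcompensates. *)
Lemma rank1_pos_def xi mu : mu < 0 -> dot (invmx H *m xi) xi = mu^-1 ->
  pos_def (H + (2 * `|mu|) *: (xi *m xi^T)).
Proof.
move=> mu0 hxi; have [_ [w wP]] := index1_hyperplane Hsym Hunit Hidx.
split; first by rewrite linearD linearZ /= trmx_mul trmxK Hsym.
move=> x x0; rewrite ltr0_norm // mulmxDl -scalemxAl -mulmxA.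
have -> : xi^T *m x = (dot xi x)%:M by rewrite [LHS]mx11_scalar dotE.
rewrite mul_mx_scalar dotDl !dotZl.
pose eta := invmx H *m xi; pose s := dot xi x; pose t := mu * s.
pose y := x - t *: eta.
have Heta : H *m eta = xi by rewrite mulKVmx.
have hee : dot (H *m eta) eta = mu^-1 by rewrite Heta dotC.
have hey : dot (H *m eta) y = 0.
  by rewrite Heta dotDr dotNr dotZr -Heta hee Heta /t mulrAC divff ?mul1r ?subrr ?ltr0_neq0.
have xE : x = t *: eta + y by rewrite addrC subrK.
clearbody y.
have hxx : dot (H *m x) x = t ^+ 2 * mu^-1 + dot (H *m y) y.
  rewrite xE mulmxDr -scalemxAr !(dotDl, dotDr, dotZl, dotZr) hee.
  by rewrite (dot_symC Hsym y eta) hey; ring.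
have tE : t ^+ 2 * mu^-1 = mu * s ^+ 2 by rewrite /t; field; rewrite ltr0_neq0.
rewrite -/s hxx tE; have [y0|y0] := eqVneq y 0.
  have s0 : s != 0.
    by apply: contraNneq x0 => s0; rewrite xE y0 /t s0 mulr0 scale0r addr0.
  have : 0 < s ^+ 2 by rewrite exprn_even_gt0.
  by rewrite y0 dotC dot0l; nra.
have hee0 : dot (H *m eta) eta < 0 by rewrite hee invr_lt0.
by have := form_orth_pos Hsym wP hee0 hey y0; nra.
Qed.

Lemma rank1_det xi mu : mu < 0 -> dot (invmx H *m xi) xi = mu^-1 ->
  \det (H + (2 * `|mu|) *: (xi *m xi^T)) = - \det H.
Proof.
move=> mu0 hxi.
have -> : H + (2 * `|mu|) *: (xi *m xi^T) =
    H *m (1%:M + ((2 * `|mu|) *: (invmx H *m xi)) *m xi^T).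
  by rewrite mulmxDr mulmx1 -scalemxAl -scalemxAr !mulmxA mulmxV // mul1mx.
rewrite det_mulmx det_rank1 -scalemxAr mxE -dotE dotC hxi ltr0_norm //.
by rewrite mulrN mulNr mulfK ?ltr0_neq0 //; ring.
Qed.

(** Split [eta] along the eigenvector [x] and its orthogonal complement,
    which is orthogonal for the form as well: the two sides agree along [x],
    while on the complement the left side is negative away from [0]. *)
Lemma neg_eigenvalue_form lam x eta : lam < 0 -> H *m x = lam *: x -> x != 0 ->
  lam * dot (H *m eta) eta <= dot (H *m eta) (H *m eta) /\
  (lam * dot (H *m eta) eta = dot (H *m eta) (H *m eta) ->
   H *m eta = lam *: eta).
Proof.
move=> lam0 Hx x0; have [_ [w wP]] := index1_hyperplane Hsym Hunit Hidx.
have xx := dot_gt0 x0.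
pose t := dot x eta / dot x x; pose y := eta - t *: x.
have etaE : eta = t *: x + y by rewrite addrC subrK.
have xy : dot x y = 0.
  by rewrite dotDr dotNr dotZr /t divfK ?subrr ?lt0r_neq0.
clearbody y.
have hxy : dot (H *m x) y = 0 by rewrite Hx dotZl xy mulr0.
have xHy : dot x (H *m y) = 0 by rewrite dotC (dot_symC Hsym).
have e1 : dot (H *m eta) eta = lam * t ^+ 2 * dot x x + dot (H *m y) y.
  rewrite etaE mulmxDr -scalemxAr !(dotDl, dotDr, dotZl, dotZr) hxy (dotC (H *m y) x) xHy.
  by rewrite Hx dotZl; ring.
have e2 : dot (H *m eta) (H *m eta) =
    lam ^+ 2 * t ^+ 2 * dot x x + dot (H *m y) (H *m y).
  rewrite etaE mulmxDr -scalemxAr Hx !(dotDl, dotDr, dotZl, dotZr) xHy.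
  by rewrite (dotC (H *m y) x) xHy; ring.
have Hy0 := dot_ge0 (H *m y).
have hx0 : dot (H *m x) x < 0 by rewrite Hx dotZl nmulr_rlt0.
rewrite e1 e2; have [y0|y0] := eqVneq y 0.
  split=> [|_]; last by rewrite etaE y0 addr0 -scalemxAr Hx !scalerA mulrC.
  by rewrite y0 mulmx0 !dot0l le_eqVlt; apply/orP; left; apply/eqP; ring.
have yneg : lam * dot (H *m y) y < 0.
  by rewrite nmulr_rlt0 // (form_orth_pos Hsym wP hx0 hxy y0).
by split=> [|eqn]; [|exfalso]; lra.
Qed.

End Negative.

Lemma perturbed_saddle (R : realType) n (H B : 'M[R]_n) :
  H^T = H -> H \in unitmx -> neg_index H = 1%N -> B^T *m H = - (H *m B) ->
  let A := H + B^T in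
  exists mu : R,
    [/\ mu < 0,
        col_eigenvalue A mu,
        forall a : R, a < 0 -> col_eigenvalue A a -> a = mu
      & geom_mult A mu = 1%N] /\
    forall xi : 'cV[R]_n, enorm xi = 1 -> A *m xi = mu *: xi ->
      (let MV := H + (2 * `|mu|) *: (xi *m xi^T) in
       pos_def MV /\ \det MV = - \det H) /\
      (forall lambda1 : R, lambda1 < 0 -> col_eigenvalue H lambda1 ->
         `|lambda1| <= `|mu| /\ (`|mu| = `|lambda1| <-> B^T *m xi = 0)) /\
      (dot (invmx H *m xi) xi = mu^-1 /\ mu^-1 < 0).
Proof.
move=> Hsym Hu Hidx; rewrite -{2}[B]trmxK => BH A.
have [mu mu0 Amu] := det_lt0_eigenvalue (det_perturbed_lt0 Hsym Hu Hidx BH).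
exists mu; split.
  split=> //; last exact: geom_mult_neg.
  move=> a a0 Aa; exact: (neg_eigenvalue_unique Hsym Hu Hidx BH).
move=> xi /dot_enorm xi1 Axi.
have hxi := invform_eigenvector Hsym Hu BH mu0 xi1 Axi.
have xi0 : xi != 0 by rewrite -dot_eq0 xi1 oner_eq0.
split; first by split; [exact: rank1_pos_def|exact: rank1_det].
split; last by rewrite invr_lt0.
move=> lam lam0 Hlam; have /col_eigenvalueP[x Hx x0] := Hlam.
have [] := neg_eigenvalue_form Hsym Hu Hidx (invmx H *m xi) lam0 Hx x0.
rewrite !mulKVmx // (dotC xi) hxi xi1 => le1 eq1.
rewrite !ltr0_norm // lerN2; split.
  by rewrite -[lam](divfK (ltr0_neq0 mu0)) ler_nMl.
split=> [/oppr_inj muE|Bxi].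
  have : xi = lam *: (invmx H *m xi) by apply: eq1; rewrite muE divff ?ltr0_neq0.
  move=> /(congr1 (mulmx H)); rewrite -scalemxAr mulKVmx // => Hxi.
  by move: Axi; rewrite mulmxDl Hxi muE => /(canRL (addKr _)); rewrite addrC subrr.
(* Uniqueness of the negative eigenvalue for the zero perturbation. *)
have Hmu : col_eigenvalue (H + 0) mu.
  apply/col_eigenvalueP; exists xi => //.
  by rewrite addr0 -Axi mulmxDl Bxi addr0.
rewrite -[H]addr0 in Hlam; congr (- _).
apply: (neg_eigenvalue_unique Hsym Hu Hidx _ mu0 lam0 Hmu Hlam).
by rewrite trmx0 mul0mx mulmx0 oppr0.
Qed.

(** * Symmetry of second derivatives *)

Section Young.
Local Open Scope classical_set_scope.
Variables (R : realType) (V : normedModType R).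
Implicit Types (f : V -> R) (x u v : V).

Lemma is_derive_line f y u (s : R) : derivable f (s *: u + y) u ->
  is_derive s 1 (fun t : R => f (t *: u + y)) ('D_u f (s *: u + y)).
Proof.
have E : (fun h : R => h^-1 *: (f (h *: u + (s *: u + y)) - f (s *: u + y))) =
    (fun h : R => h^-1 *: (f ((h *: 1 + s) *: u + y) - f (s *: u + y))).
  by apply/funext => h /=; rewrite scalerDl [h *: 1]mulr1 addrA.
move=> df; apply: DeriveDef; first by rewrite /derivable -E.
by rewrite /derive -E.
Qed.

Definition second_difference f x u v : R :=
  f (x + u + v) - f (x + u) - f (x + v) + f x.

Lemma second_differenceC f x u v :
  second_difference f x u v = second_difference f x v u.
Proof. by rewrite /second_difference -!addrA (addrC u); ring. Qed.

(** The mean value theorem applied to [s |-> f (x + s u + t v) - f (x + s u)]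
    on [[0, t]] leaves an increment of ['D_u f] near [x], which is linear in
    [t] up to a small error by differentiability. *)
Lemma second_difference_approx f x u v :
  (forall y, derivable f y u) -> differentiable ('D_u f) x ->
  forall e : R, 0 < e -> \forall t \near 0^'+,
    `|second_difference f x (t *: u) (t *: v) - t ^+ 2 * 'D_v ('D_u f) x| <=
    e * t ^+ 2.
Proof.
move=> df dF e e0; pose F : V -> R := 'D_u f.
(* Bounds the sum of the norms of the two increments below, divided by [t];
   the [1 +] keeps it positive. *)
pose k := 1 + (`|u| + `|u| + `|v|); have k0 : 0 < k.
  by rewrite /k ltr_pwDl ?ltr01 // !addr_ge0.
have : \forall h \near (0 : V), `|F (h + x) - (F x + 'd F x h)| <= e / k * `|h|.
  by have /eqaddoP := diff_locally dF; apply; rewrite divr_gt0.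
move=> /nbhs_norm0P[/= d d0 Hd].
near=> t.
have t0 : 0 < t by near: t; exact: nbhs_right_gt.
have td : t < d / k by near: t; apply: nbhs_right_lt; rewrite divr_gt0.
pose g (s : R) : R := f (s *: u + (x + t *: v)) - f (s *: u + x).
have dg (s : R) : is_derive s (1 : R) g (F (s *: u + (x + t *: v)) - F (s *: u + x)).
  by apply: is_deriveB; apply: is_derive_line.
have [|c] := @MVT _ g _ 0 t t0 (fun s _ => dg s).
  apply: continuous_subspaceT => s; apply: differentiable_continuous.
  by apply/derivable1_diffP; apply: ex_derive.
rewrite in_itv /= => /andP[c0 ct]; rewrite subr0 => gE.
have -> : second_difference f x (t *: u) (t *: v) = g t - g 0.
  rewrite /second_difference /g scale0r !add0r.
  by rewrite [x + t *: v]addrC addrA [t *: u + _ + x]addrAC ![_ *: u + x]addrC; ring.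
rewrite gE; set dg' := (X in X * t).
have dvE : 'D_v F x = 'd F x v by rewrite deriveE.
have -> : dg' * t - t ^+ 2 * 'D_v F x = t * (dg' - t * 'd F x v).
  by rewrite dvE; ring.
have -> : dg' - t * 'd F x v =
    (F ((c *: u + t *: v) + x) - (F x + 'd F x (c *: u + t *: v))) -
    (F (c *: u + x) - (F x + 'd F x (c *: u))).
  have -> : 'd F x (c *: u + t *: v) = 'd F x (c *: u) + t * 'd F x v.
    by rewrite linearD [X in _ + X = _]linearZ.
  by rewrite /dg' [x + _]addrC addrA; ring.
have nu : `|c *: u| <= t * `|u|.
  by rewrite normrZ (gtr0_norm c0) ler_wpM2r // ltW.
have nuv : `|c *: u + t *: v| <= t * `|u| + t * `|v|.
  by rewrite (le_trans (ler_normD _ _)) // lerD // normrZ (gtr0_norm t0).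
rewrite normrM (gtr0_norm t0) expr2 mulrCA ler_pM2l //.
have tk : t * k < d by rewrite -ltr_pdivlMr.
have tkE : t * k = t + (t * `|u| + t * `|u| + t * `|v|) by rewrite /k; ring.
have tu0 : 0 <= t * `|u| by rewrite mulr_ge0 // ltW.
have tv0 : 0 <= t * `|v| by rewrite mulr_ge0 // ltW.
apply: (le_trans (ler_normB _ _)).
have H1 := Hd (c *: u + t *: v) _; have H2 := Hd (c *: u) _.
apply: (le_trans (lerD (H1 _) (H2 _))); [by rewrite /= ; lra..|].
rewrite -mulrDr -[leRHS]mulr1 -mulrA -mulrA ler_pM2l // mulrC ler_pdivrMr //.
by rewrite mulr1; lra.
Unshelve. all: by end_near.
Qed.

(** The second difference is symmetric in [u] and [v], so both mixed
    derivatives are its limit after division by [t ^ 2]. *)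
Lemma derive_deriveC f x u v :
  (forall y, differentiable f y) ->
  differentiable ('D_u f) x -> differentiable ('D_v f) x ->
  'D_v ('D_u f) x = 'D_u ('D_v f) x.
Proof.
move=> df du dv; apply/eqP; rewrite eq_sym -subr_eq0 -normr_le0.
apply/ler_addgt0Pr => e e0; rewrite add0r.
have e20 : 0 < e / 2 by rewrite divr_gt0.
have der w y : derivable f y w by exact: diff_derivable.
have approx w z (dw : differentiable ('D_w f) x) :=
  @second_difference_approx f x w z (der w) dw _ e20.
have gt0 : \forall t \near (0 : R)^'+, 0 < t := nbhs_right_gt 0.
have [t [t0 [H1 H2]]] := @filter_ex _ (0 : R)^'+ _ _
  (filterI gt0 (filterI (approx u v du) (approx v u dv))).
rewrite second_differenceC in H2.
have t20 : 0 < t ^+ 2 by rewrite exprn_gt0.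
move: ('D_v ('D_u f) x) ('D_u ('D_v f) x) H1 H2 => p q H1.
rewrite distrC => H2.
have {1}-> : e = e / 2 + e / 2 by rewrite -splitr.
rewrite -(ler_pM2r t20) mulrDl; apply: le_trans (lerD H2 H1).
apply: le_trans (ler_normD _ _); rewrite -[X in _ * X](gtr0_norm t20) -normrM.
by rewrite le_eqVlt; apply/orP; left; apply/eqP; congr (`| _ |); ring.
Qed.

End Young.

(** * Partial derivatives of smooth functions *)

Section Partial.
Variables (R : realType) (d : nat).
Implicit Types (f g : 'cV[R]_d -> R) (x : 'cV[R]_d).

Lemma smooth_diff f x : smooth f -> differentiable f x.
Proof. by move=> sf; exact: (sf [::] x). Qed.

Lemma smooth_partial f i : smooth f -> smooth (partial i f).
Proof. by move=> sf s x; have := sf (rcons s i) x; rewrite foldr_rcons. Qed.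

Lemma partialD f g i x : differentiable f x -> differentiable g x ->
  partial i (fun y => f y + g y) x = partial i f x + partial i g x.
Proof. by move=> df dg; apply: deriveD; exact: diff_derivable. Qed.

Lemma partialB f g i x : differentiable f x -> differentiable g x ->
  partial i (fun y => f y - g y) x = partial i f x - partial i g x.
Proof. by move=> df dg; apply: deriveB; exact: diff_derivable. Qed.

Lemma partialM f g i x : differentiable f x -> differentiable g x ->
  partial i (fun y => f y * g y) x = partial i f x * g x + f x * partial i g x.
Proof.
move=> df dg; rewrite /partial deriveM; [|exact: diff_derivable..].
by rewrite addrC mulrC.
Qed.

Lemma partialZ f (c : R) i x : differentiable f x ->
  partial i (fun y => c * f y) x = c * partial i f x.
Proof. by move=> df; apply: deriveZ; exact: diff_derivable. Qed.

Lemma partial_sum n (F : 'I_n -> 'cV[R]_d -> R) i x :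
  (forall k, differentiable (F k) x) ->
  partial i (fun y => \sum_k F k y) x = \sum_k partial i (F k) x.
Proof.
move=> dF; rewrite /partial -derive_sum; last by move=> k; exact: diff_derivable.
by congr ('D_ _ _ _); apply/funext => y; rewrite fct_sumE.
Qed.

Lemma partial_expR f i x : differentiable f x ->
  partial i (fun y => expR (f y)) x = expR (f x) * partial i f x.
Proof.
move=> df; have dexp : differentiable (@expR R) (f x).
  exact/derivable1_diffP/derivable_expR.
rewrite /partial !deriveE //; last exact: differentiable_comp.
rewrite (diff_comp df dexp) /= diff1E //.
have -> : derive1 (@expR R) (f x) = expR (f x) by rewrite derive1E derive_val.
exact: mulrC.
Qed.

Lemma hess_sym f x : smooth f -> (hess f x)^T = hess f x.
Proof.
move=> sf; apply/matrixP => i j; rewrite !mxE; apply: derive_deriveC.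
- by move=> y; exact: smooth_diff.
- exact: (sf [:: i]).
- exact: (sf [:: j]).
Qed.

End Partial.

(** * Stationarity of the Gibbs density *)

Section Diffusion.
Variables (R : realType) (d : nat).
Implicit Types (f g V : 'cV[R]_d -> R) (x : 'cV[R]_d).

Lemma smoothB f g : smooth f -> smooth g -> smooth (fun x => f x - g x).
Proof.
move=> sf sg s; have -> : foldr partial (fun x => f x - g x) s =
    (fun x => foldr partial f s x - foldr partial g s x).
  elim: s => //= i s ->; apply/funext => x.
  by rewrite partialB; [|exact: sf|exact: sg].
by move=> x; apply: differentiableB; [exact: sf|exact: sg].
Qed.

Lemma smooth_bfield (U0 : 'cV[R]_d -> 'cV[R]_d) V : smooth_field U0 -> smooth V ->
  smooth_field (bfield U0 V).
Proof.
move=> sU sV i; have -> : (fun x => bfield U0 V x i 0) =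
    (fun x => U0 x i 0 - partial i V x).
  by apply/funext => x; rewrite !mxE.
by apply: smoothB; [exact: sU|exact: smooth_partial].
Qed.

(** The factor [h] cancels the [1 / h] of the logarithmic derivative, so that
    the flux is the density times [bfield + h nu]. *)
Lemma Ldag_gibbs (U0 nu : 'cV[R]_d -> 'cV[R]_d) V h x : 0 < h ->
  smooth_field U0 -> smooth_field nu -> smooth V ->
  Ldag U0 nu h (fun y => expR (- (V y / h))) x =
  - expR (- (V x / h)) *
    (\sum_i partial i (fun y => bfield U0 V y i 0) x
     + h * \sum_i partial i (fun y => nu y i 0) x
     - h^-1 * \sum_i bfield U0 V x i 0 * partial i V x
     - \sum_i nu x i 0 * partial i V x).
Proof.
move=> h0 sU snu sV; have sb := smooth_bfield sU sV.
have h_neq0 : h != 0 by rewrite gt_eqF.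
pose u y := expR (- (V y / h)); rewrite /Ldag /div.
have dE : (fun y => - (V y / h)) = (fun y => - h^-1 * V y).
  by apply/funext => y; rewrite mulrC mulNr.
have dV y : differentiable (fun z => - (V z / h)) y.
  rewrite dE; apply: differentiableM => //; exact: smooth_diff.
have du y : differentiable u y.
  apply: (differentiable_comp (dV y)).
  exact/derivable1_diffP/derivable_expR.
have pw i y : partial i (fun z => - (V z / h)) y = - h^-1 * partial i V y.
  by rewrite dE (partialZ _ _ (smooth_diff y sV)).
have pu i y : partial i u y = - h^-1 * (u y * partial i V y).
  by have := partial_expR i (dV y); rewrite pw mulrCA.
have E i : (fun y => (h *: grad u y + u y *: Uh U0 nu h y) i 0) =
    (fun y => u y * (bfield U0 V y i 0 + h * nu y i 0)).
  apply/funext => y; rewrite !mxE pu.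
  by rewrite mulrA mulrN divff // mulN1r; ring.
rewrite (eq_bigr (fun i => u x * (partial i (fun y => bfield U0 V y i 0) x
     + h * partial i (fun y => nu y i 0) x
     - h^-1 * (bfield U0 V x i 0 * partial i V x)
     - nu x i 0 * partial i V x))) => [|i _].
  by rewrite -mulr_sumr !sumrB big_split /= -!mulr_sumr mulNr.
have dhnu : differentiable (fun y => h * nu y i 0) x.
  by apply: differentiableM => //; exact: smooth_diff.
have db : differentiable (fun y => bfield U0 V y i 0) x by exact: smooth_diff.
rewrite E partialM //; last exact: differentiableD.
rewrite partialD // partialZ; last exact: smooth_diff.
rewrite pu; move: (partial i _ x) (partial i _ x) (partial i _ x) => p q r.
by field.
Qed.

(** The bracket in [Ldag_gibbs] is a Laurent polynomial in [h] with three
    coefficients, so three values of [h] determine that of [1 / h]. *)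
Lemma stationary_orthogonal (U0 nu : 'cV[R]_d -> 'cV[R]_d) V :
  smooth_field U0 -> smooth_field nu -> smooth V -> stationary U0 nu V ->
  forall x, \sum_i bfield U0 V x i 0 * partial i V x = 0.
Proof.
move=> sU snu sV st x.
set Z := \sum_i _.
pose X := \sum_i partial i (fun y => bfield U0 V y i 0) x.
pose Y := \sum_i partial i (fun y => nu y i 0) x.
pose W := \sum_i nu x i 0 * partial i V x.
have key h : 0 < h <= 1 -> X + h * Y - h^-1 * Z - W = 0.
  move=> h01; have /andP[h0 _] := h01.
  have := st h h01 x; rewrite Ldag_gibbs // => /eqP.
  by rewrite mulf_eq0 oppr_eq0 gt_eqF ?expR_gt0 //= => /eqP.
clearbody X Y W Z.
have k1 : X + 1 * Y - 1^-1 * Z - W = 0 by apply: key; lra.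
have k2 : X + 2^-1 * Y - 2^-1^-1 * Z - W = 0 by apply: key; lra.
have k4 : X + 4^-1 * Y - 4^-1^-1 * Z - W = 0 by apply: key; lra.
by move: k1 k2 k4; rewrite invr1 !invrK; lra.
Qed.

(** First order at [x]: [hess V x *m b x = 0], hence [b x = 0].  Second order:
    the terms carrying [b x] or [grad V x] drop out, leaving the symmetric
    part of [hess V x *m jac b x]. *)
Lemma orthogonal_critical (b : 'cV[R]_d -> 'cV[R]_d) V x :
  smooth_field b -> smooth V -> (forall y, \sum_i b y i 0 * partial i V y = 0) ->
  critical V x -> hess V x \in unitmx ->
  (jac b x)^T *m hess V x = - (hess V x *m jac b x).
Proof.
move=> sb sV bV crit Hu.
have pV0 i : partial i V x = 0.
  by have /colP/(_ i) := crit; rewrite !mxE.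
have d1 j y : \sum_i (partial j (fun z => b z i 0) y * partial i V y +
                      b y i 0 * partial j (partial i V) y) = 0.
  have : partial j (fun y => \sum_i b y i 0 * partial i V y) y = 0.
    rewrite (_ : (fun y => _) = cst 0); first exact: derive_cst.
    exact/funext.
  rewrite partial_sum => [E|i].
    apply: etrans E; apply: eq_bigr => i _; rewrite partialM //; first exact: smooth_diff.
    exact/smooth_diff/smooth_partial.
  apply: differentiableM; first exact: smooth_diff.
  exact/smooth_diff/smooth_partial.
have b0 : b x = 0.
  have Hb : hess V x *m b x = 0.
    apply/colP => j; rewrite !mxE -[RHS](d1 j x); apply: eq_bigr => i _.
    by rewrite !mxE pV0 mulr0 add0r mulrC.
  by rewrite -[b x](mulKmx Hu) Hb mulmx0.
apply/eqP; rewrite -addr_eq0; apply/eqP/matrixP => k j; rewrite !mxE -big_split /=.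
have : partial j (fun y => \sum_i (partial k (fun z => b z i 0) y * partial i V y +
                      b y i 0 * partial k (partial i V) y)) x = 0.
  rewrite (_ : (fun y => _) = cst 0); first exact: derive_cst.
  exact/funext.
have dpb i m : differentiable (partial m (fun z => b z i 0)) x.
  exact/smooth_diff/smooth_partial.
have dpV i : differentiable (partial i V) x by exact/smooth_diff/smooth_partial.
have dppV i m : differentiable (partial m (partial i V)) x.
  exact/smooth_diff/smooth_partial/smooth_partial.
have db i : differentiable (fun z => b z i 0) x by exact: smooth_diff.
rewrite partial_sum => [E|i]; last by apply: differentiableD; apply: differentiableM.
apply: etrans E; apply: eq_bigr => i _; rewrite partialD; [|exact: differentiableM..].
rewrite !mxE; have -> : partial i (partial j V) x = partial j (partial i V) x.
  by have /matrixP/(_ j i) := hess_sym x sV; rewrite !mxE.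
rewrite (partialM j (dpb i k) (dpV i)) (partialM j (db i) (dppV i k)) pV0 b0 mxE.
move: (partial j (partial i V) x) (partial k (partial i V) x) => p q.
move: (partial k (fun z => b z i 0) x) (partial j (fun z => b z i 0) x) => r t.
move: (partial j (partial k _) x) (partial j (partial k _) x) => u v.
by ring.
Qed.

End Diffusion.

(** * The saddle point *)

Theorem lemma1p8 (R : realType) (d : nat) (d_ge2 : (2 <= d)%N)
    (U0 nu : 'cV[R]_d -> 'cV[R]_d) (V : 'cV[R]_d -> R)
    (U0_smooth : smooth_field U0) (nu_smooth : smooth_field nu)
    (V_smooth : smooth V)
    (assumption1 : stationary U0 nu V)
    (assumption2 : growth (bfield U0 V) nu V)
    (assumption3 : morse V)
    (s : 'cV[R]_d) (s_saddle : saddle V s) :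
  let H := hess V s in
  let B := jac (bfield U0 V) s in
  let A := H + B^T in
  exists mu : R,
    (* (i) *)
    [/\ mu < 0,
        col_eigenvalue A mu,
        forall a : R, a < 0 -> col_eigenvalue A a -> a = mu
      & geom_mult A mu = 1%N] /\
    forall xi : 'cV[R]_d, enorm xi = 1 -> A *m xi = mu *: xi ->
      (* (ii) *)
      (let MV := H + (2 * `|mu|) *: (xi *m xi^T) in
       pos_def MV /\ \det MV = - \det H) /\
      (* (iii) *)
      (forall lambda1 : R, lambda1 < 0 -> col_eigenvalue H lambda1 ->
         `|lambda1| <= `|mu| /\ (`|mu| = `|lambda1| <-> B^T *m xi = 0)) /\
      (dot (invmx H *m xi) xi = mu^-1 /\ mu^-1 < 0).
Proof.
move=> H B; have [crit idx] := s_saddle; have Hu := assumption3 s crit.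
apply: perturbed_saddle => //; first exact: hess_sym.
apply: orthogonal_critical => //; first exact: smooth_bfield.
exact: (stationary_orthogonal U0_smooth nu_smooth V_smooth assumption1).
Qed.
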